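(* Let $q_a\neq 0$ and $p_a>0$ be fixed real numbers. For $\varepsilon>0$ let $q_\varepsilon\colon\mathbb{R}\to\mathbb{R}$ solve $$q_\varepsilon''(t)=-\frac1\varepsilon V'\!\left(\frac{q_\varepsilon(t)}{\varepsilon}\right),\quad t\in\mathbb{R},$$ subject to $q_\varepsilon(0)=q_a$ and $q_\varepsilon'(0)=p_a$. Then there exists a non-empty interval $I$, depending only on $\min V$ and $p_a$, such that for all $\alpha\in I$ there exists a sequence $\{\varepsilon_k\}_{k\in\mathbb{N}}$ of positive numbers converging to zero such that the corresponding solutions $q_{\varepsilon_k}$ converge uniformly (on $\mathbb{R}$) to the line $q(t)=\alpha t+q_a$. In particular, if $p_a<\sqrt{-2\min V}$, then $\inf I=0$.
   Context: $V\in C^2(\mathbb{R})$ is $1$-periodic with $\max V=0$. *)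

(* Defs.v *)
From Stdlib Require Import Reals.
From Coquelicot Require Import Coquelicot.
Open Scope R_scope.

(* All orders k <= n are required: [ex_derive_n f n x] alone says nothing
   about the lower orders, since [Derive] is total. *)
Definition is_Cn (n : nat) (f : R -> R) : Prop :=
  (forall (k : nat) (x : R), (k <= n)%nat -> ex_derive_n f k x) /\
  (forall x : R, continuous (Derive_n f n) x).

Definition periodic (T : R) (f : R -> R) : Prop :=
  forall x : R, f (x + T) = f x.

Definition is_max_of (f : R -> R) (M : R) : Prop :=
  (exists x : R, f x = M) /\ (forall x : R, f x <= M).

Definition is_min_of (f : R -> R) (m : R) : Prop :=
  (exists x : R, f x = m) /\ (forall x : R, m <= f x).

Definition solves_ivp (V : R -> R) (qa pa eps : R) (q : R -> R) : Prop :=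
  (forall t : R, ex_derive q t) /\
  (forall t : R, is_derive (Derive q) t (- (1 / eps) * Derive V (q t / eps))) /\
  q 0 = qa /\ Derive q 0 = pa.

(* Any order-convex set, so singletons are allowed: for V = 0 every solution
   is t |-> pa * t + qa, and pa is the only limiting slope. *)
Definition is_interval (I : R -> Prop) : Prop :=
  forall x y z : R, I x -> I z -> x <= y <= z -> I y.

(* Neighbourhoods in [fct_UniformSpace] are those of the sup distance over
   the whole domain. *)
Definition converges_uniformly (f : nat -> R -> R) (g : R -> R) : Prop :=
  filterlim f eventually (@locally (fct_UniformSpace R R_UniformSpace) g).

(* Main.v *)
Require Import Defs.
From Stdlib Require Import ZArith Reals Lra Lia.
From Coquelicot Require Import Coquelicot.
Open Scope R_scope.

(** A solution conserves [Derive q t ^ 2 / 2 + V (q t / eps) = E], where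
    [E = pa ^ 2 / 2 + V (qa / eps)]. If [E > 0 = max V], the velocity never
    vanishes, so the particle moves to the right at speed
    [sqrt (2 * (E - V (q / eps)))]. Let [G] be the travel time, a primitive of
    [1 / sqrt (2 * (E - V))]. Then [eps * G (q t / eps) - t] is constant, and
    [G y - y * T] is [1]-periodic and bounded by [T], where [T = G 1] is the time
    needed to cross one period. Therefore [q] stays within [2 * eps] of the line
    of slope [1 / T] through [qa], for all times ([solves_ivp_near_line]).

    It remains to choose [E]. As [eps] tends to [0], the argument [qa / eps] tends
    to infinity, so every value of [V] is attained at [qa / eps] along some
    sequence of scales ([periodic_value_at_small_scales]); hence every energy [E]
    between [pa ^ 2 / 2 + min V] and [pa ^ 2 / 2] can be kept fixed along a
    sequence. The crossing time [T] is continuous in [E > 0], is at most [1 / pa]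
    at the largest energy, and is at least [1 / pa] at the smallest one if that is
    positive. If the smallest energy is not positive, [T] is unbounded as [E]
    decreases to [0], because [V] is bounded below by a quadratic near its maximum
    ([crossing_large_at_low_energy]). By the intermediate value theorem the slope
    [pa] is always attained, and every slope in [(0, pa]] is attained when
    [pa < sqrt (-2 * min V)]. These slopes form the interval. *)

(** * Monotonicity from the sign of the derivative *)

Lemma is_derive_nondecreasing (f df : R -> R) (a b : R) :
  (forall x, a <= x <= b -> is_derive f x (df x)) ->
  (forall x, a <= x <= b -> 0 <= df x) ->
  a <= b -> f a <= f b.
Proof.
  intros Hd Hpos Hab.
  destruct (MVT_gen f a b df) as [c [Hc Heq]];
    rewrite ?Rmin_left, ?Rmax_right in * by assumption.
  - intros x Hx; apply Hd; lra.
  - intros x Hx. apply continuity_pt_filterlim.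
    apply (ex_derive_continuous f). exists (df x); apply Hd, Hx.
  - assert (0 <= df c * (b - a)) by (apply Rmult_le_pos; [auto | lra]).
    lra.
Qed.

Lemma is_derive_0_const (f : R -> R) :
  (forall x, is_derive f x 0) -> forall x y, f x = f y.
Proof.
  assert (Hle : forall f : R -> R, (forall x, is_derive f x 0) ->
            forall x y, x < y -> f x = f y).
  { intros g Hg x y Hxy. apply (eq_is_derive g x y); [|assumption].
    intros t _; apply Hg. }
  intros Hf x y. destruct (Rtotal_order x y) as [H | [-> | H]]; auto.
  symmetry; auto.
Qed.

(** * Slowness and travel time at a fixed energy *)

(** The reciprocal of the speed at position [z] of a particle of unit mass and
    energy [E] in the potential [V]. *)
Definition slowness (V : R -> R) (E z : R) : R := / sqrt (2 * (E - V z)).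

(** The signed time needed to travel from [0] to [x] at energy [E]. *)
Definition travel (V : R -> R) (E x : R) : R := RInt (slowness V E) 0 x.

(** The time needed to cross one period cell of a [1]-periodic potential. *)
Definition crossing (V : R -> R) (E : R) : R := travel V E 1.

Section TravelTime.

Variable V : R -> R.
Hypothesis V_diff : forall x, ex_derive V x.
Hypothesis V_per : periodic 1 V.
Hypothesis V_le0 : forall x, V x <= 0.

Lemma potential_continuity : continuity V.
Proof.
  intros x. apply continuity_pt_filterlim.
  apply (ex_derive_continuous V). apply V_diff.
Qed.

Lemma speed_pos (E z : R) : 0 < E -> 0 < sqrt (2 * (E - V z)).
Proof. intros HE. specialize (V_le0 z). apply sqrt_lt_R0; lra. Qed.

Lemma slowness_pos (E z : R) : 0 < E -> 0 < slowness V E z.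
Proof. intros HE. apply Rinv_0_lt_compat, speed_pos, HE. Qed.

Lemma slowness_continuous (E z : R) : 0 < E -> continuous (slowness V E) z.
Proof.
  intros HE. apply (ex_derive_continuous (slowness V E)). unfold slowness.
  pose proof (speed_pos E z HE). specialize (V_le0 z). pose proof (V_diff z).
  auto_derive. repeat split; auto; try lra.
  apply Rgt_not_eq. assumption.
Qed.

Lemma ex_RInt_slowness (E a b : R) : 0 < E -> ex_RInt (slowness V E) a b.
Proof.
  intros HE. apply (ex_RInt_continuous (slowness V E)).
  intros z _; apply slowness_continuous, HE.
Qed.

Lemma is_derive_travel (E x : R) :
  0 < E -> is_derive (travel V E) x (slowness V E x).
Proof.
  intros HE. apply (is_derive_RInt (slowness V E) _ 0).
  - apply filter_forall. intros y.
    apply (@RInt_correct R_CompleteNormedModule), ex_RInt_slowness, HE.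
  - apply slowness_continuous, HE.
Qed.

Lemma travel_0 (E : R) : travel V E 0 = 0.
Proof. unfold travel. apply (RInt_point 0 (slowness V E)). Qed.

Lemma travel_le (E x y : R) : 0 < E -> x <= y -> travel V E x <= travel V E y.
Proof.
  intros HE Hxy. apply (is_derive_nondecreasing _ (slowness V E)); auto.
  - intros z _; apply is_derive_travel, HE.
  - intros z _; apply Rlt_le, slowness_pos, HE.
Qed.

Lemma travel_shift (E x : R) :
  0 < E -> travel V E (x + 1) = travel V E x + crossing V E.
Proof.
  intros HE.
  assert (H : forall y, is_derive (fun y => travel V E (y + 1) - travel V E y) y 0).
  { intros y.
    replace 0 with (1 * slowness V E (y + 1) - slowness V E y)
      by (unfold slowness; rewrite V_per; ring).
    apply (is_derive_minus (fun y => travel V E (y + 1)) (travel V E)).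
    - apply (is_derive_comp (travel V E) (fun y => y + 1)).
      + apply is_derive_travel, HE.
      + auto_derive; trivial.
    - apply is_derive_travel, HE. }
  pose proof (is_derive_0_const _ H x 0) as Heq. cbv beta in Heq.
  rewrite travel_0, Rplus_0_l in Heq. fold (crossing V E) in Heq. lra.
Qed.

Lemma travel_shift_nat (E x : R) (n : nat) :
  0 < E -> travel V E (x + INR n) = travel V E x + INR n * crossing V E.
Proof.
  intros HE. induction n as [|n IH].
  - simpl. rewrite Rplus_0_r. ring.
  - rewrite S_INR, <- Rplus_assoc, travel_shift, IH by assumption. ring.
Qed.

Lemma travel_shift_Z (E x : R) (n : Z) :
  0 < E -> travel V E (x + IZR n) = travel V E x + IZR n * crossing V E.
Proof.
  intros HE. destruct (Z.le_gt_cases 0 n) as [Hn | Hn].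
  - rewrite <- (Z2Nat.id n), <- INR_IZR_INZ by assumption.
    apply travel_shift_nat, HE.
  - pose proof (travel_shift_nat E (x + IZR n) (Z.to_nat (- n)) HE) as H.
    rewrite INR_IZR_INZ, Z2Nat.id, opp_IZR in H by lia.
    replace (x + IZR n + - IZR n) with x in H by ring. lra.
Qed.

Lemma crossing_pos (E : R) : 0 < E -> 0 < crossing V E.
Proof.
  intros HE. apply RInt_gt_0; [lra | |].
  - intros; apply slowness_pos, HE.
  - intros; apply slowness_continuous, HE.
Qed.

(** The travel time stays within one crossing time of its linear
    interpolation at the integers. *)
Lemma travel_near_linear (E y : R) :
  0 < E -> Rabs (travel V E y - y * crossing V E) <= crossing V E.
Proof.
  intros HE.
  pose proof (archimed y) as [H1 H2].
  set (n := (up y - 1)%Z).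
  assert (Hn : IZR n = IZR (up y) - 1) by (unfold n; apply minus_IZR).
  set (r := y - IZR n).
  replace y with (r + IZR n) by (unfold r; ring).
  rewrite travel_shift_Z by assumption.
  assert (Hr : 0 <= r <= 1) by (unfold r; lra).
  assert (Hl : 0 <= travel V E r)
    by (rewrite <- (travel_0 E); apply travel_le; [assumption | lra]).
  assert (Hu : travel V E r <= crossing V E)
    by (apply travel_le; [assumption | lra]).
  pose proof (crossing_pos E HE) as HT.
  assert (0 <= r * crossing V E) by (apply Rmult_le_pos; lra).
  assert (0 <= (1 - r) * crossing V E) by (apply Rmult_le_pos; lra).
  apply Rabs_le. lra.
Qed.

(** * The crossing time as a function of the energy *)

Lemma crossing_le_inv (E p : R) :
  0 < E -> 0 < p -> (forall z, p ^ 2 <= 2 * (E - V z)) -> crossing V E <= / p.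
Proof.
  intros HE Hp H.
  replace (/ p) with (RInt (fun _ => / p) 0 1)
    by (rewrite RInt_const; unfold scal; simpl; unfold mult; simpl; ring).
  apply RInt_le; [lra | apply ex_RInt_slowness, HE | apply ex_RInt_const |].
  intros z _. apply Rinv_le_contravar; [assumption|].
  rewrite <- (sqrt_pow2 p) by lra. apply sqrt_le_1_alt, H.
Qed.

Lemma crossing_ge_inv (E p : R) :
  0 < E -> 0 < p -> (forall z, 2 * (E - V z) <= p ^ 2) -> / p <= crossing V E.
Proof.
  intros HE Hp H.
  replace (/ p) with (RInt (fun _ => / p) 0 1)
    by (rewrite RInt_const; unfold scal; simpl; unfold mult; simpl; ring).
  apply RInt_le; [lra | apply ex_RInt_const | apply ex_RInt_slowness, HE |].
  intros z _. apply Rinv_le_contravar; [apply speed_pos, HE|].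
  rewrite <- (sqrt_pow2 p) by lra. apply sqrt_le_1_alt, H.
Qed.

Lemma Rinv_sqrt_lipschitz (c A B : R) :
  0 < c -> c ^ 2 <= A -> c ^ 2 <= B ->
  Rabs (/ sqrt A - / sqrt B) <= Rabs (A - B) / c ^ 3.
Proof.
  intros Hc HA HB.
  assert (Hs : forall X, c ^ 2 <= X -> c <= sqrt X).
  { intros X HX. rewrite <- (sqrt_pow2 c) by lra. apply sqrt_le_1_alt, HX. }
  pose proof (Hs A HA) as HsA. pose proof (Hs B HB) as HsB.
  assert (Hc2 : 0 < c ^ 2) by (apply pow_lt; assumption).
  assert (Hc3 : 0 < c ^ 3) by (apply pow_lt; assumption).
  assert (HA2 : sqrt A * sqrt A = A) by (apply sqrt_def; lra).
  assert (HB2 : sqrt B * sqrt B = B) by (apply sqrt_def; lra).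
  set (s := sqrt A) in *. set (r := sqrt B) in *.
  assert (Hsr : c * c <= s * r) by (apply Rmult_le_compat; lra).
  assert (Hden : c ^ 3 <= (s * r) * (s + r)).
  { replace (c ^ 3) with (c * c * c) by ring.
    apply Rmult_le_compat; nra. }
  replace (/ s - / r) with (- ((A - B) * / ((s * r) * (s + r)))).
  2:{ rewrite <- HA2, <- HB2. field. repeat split; lra. }
  rewrite Rabs_Ropp, Rabs_mult.
  apply Rmult_le_compat_l; [apply Rabs_pos|].
  rewrite Rabs_right by (apply Rle_ge, Rlt_le, Rinv_0_lt_compat; lra).
  apply Rinv_le_contravar; assumption.
Qed.

Lemma crossing_lipschitz (c E1 E2 : R) :
  0 < c -> c ^ 2 <= 2 * E1 -> c ^ 2 <= 2 * E2 ->
  Rabs (crossing V E1 - crossing V E2) <= 2 * Rabs (E1 - E2) / c ^ 3.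
Proof.
  intros Hc H1 H2.
  assert (Hc2 : 0 < c ^ 2) by (apply pow_lt; assumption).
  assert (X1 := ex_RInt_slowness E1 0 1 ltac:(lra)).
  assert (X2 := ex_RInt_slowness E2 0 1 ltac:(lra)).
  unfold crossing, travel.
  replace (RInt (slowness V E1) 0 1 - RInt (slowness V E2) 0 1)
    with (RInt (fun z => minus (slowness V E1 z) (slowness V E2 z)) 0 1)
    by (rewrite (RInt_minus (slowness V E1) (slowness V E2)); auto).
  replace (2 * Rabs (E1 - E2) / c ^ 3)
    with ((1 - 0) * (2 * Rabs (E1 - E2) / c ^ 3)) by ring.
  apply abs_RInt_le_const; [lra | |].
  - apply (ex_RInt_minus (slowness V E1) (slowness V E2)); assumption.
  - intros z _. change (Rabs (slowness V E1 z - slowness V E2 z) <= 2 * Rabs (E1 - E2) / c ^ 3).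
    pose proof (V_le0 z). unfold slowness.
    replace (2 * Rabs (E1 - E2)) with (Rabs (2 * (E1 - V z) - 2 * (E2 - V z))).
    + apply Rinv_sqrt_lipschitz; lra.
    + rewrite <- (Rabs_right 2) at 3 by lra. rewrite <- Rabs_mult. f_equal. ring.
Qed.

(** The Lipschitz estimate is applied on the energies above [E / 2], where the
    speed is at least [sqrt E]. *)
Lemma crossing_continuity_pt (E : R) : 0 < E -> continuity_pt (crossing V) E.
Proof.
  intros HE.
  set (c := sqrt E).
  assert (Hc : 0 < c) by (apply sqrt_lt_R0; assumption).
  assert (Hc2 : c ^ 2 = E) by (apply pow2_sqrt; lra).
  assert (Hc3 : 0 < c ^ 3) by (apply pow_lt; assumption).
  intros e He. exists (Rmin (E / 2) (e * c ^ 3 / 4)). split.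
  { apply Rmin_pos; [lra|]. assert (0 < e * c ^ 3) by (apply Rmult_lt_0_compat; lra). lra. }
  intros F [_ HF]. simpl in *. unfold R_dist, Rdist in *.
  pose proof (Rmin_l (E / 2) (e * c ^ 3 / 4)).
  pose proof (Rmin_r (E / 2) (e * c ^ 3 / 4)).
  assert (HF' : E / 2 <= F).
  { assert (Hb : Rabs (F - E) < E / 2) by (eapply Rlt_le_trans; eassumption).
    apply Rabs_def2 in Hb. lra. }
  eapply Rle_lt_trans; [apply (crossing_lipschitz c); try assumption; lra|].
  apply Rmult_lt_reg_r with (c ^ 3); [assumption|].
  replace (2 * Rabs (F - E) / c ^ 3 * c ^ 3) with (2 * Rabs (F - E)) by (field; lra).
  simpl in *.
  assert (0 < e * (c * (c * (c * 1)))) by (apply Rmult_lt_0_compat; lra).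
  lra.
Qed.

(** Near a point where [V] attains its maximum [0], the potential is bounded
    below by a quadratic, because [V'] vanishes there and is differentiable. *)
Lemma potential_quadratic_below_max (x0 : R) :
  V x0 = 0 -> ex_derive (Derive V) x0 ->
  exists b d : R, 0 < b /\ 0 < d <= 1 /\
    forall u, 0 <= u <= d -> - (b ^ 2 * u ^ 2) <= 2 * V (x0 + u).
Proof.
  intros Hx0 [l Hl].
  assert (HD0 : Derive V x0 = 0).
  { assert (pr : derivable_pt V x0) by (apply ex_derive_Reals_0, V_diff).
    rewrite <- (Derive_Reals V x0 pr).
    apply (deriv_maximum V (x0 - 1) (x0 + 1)); try lra.
    intros; rewrite Hx0; apply V_le0. }
  set (K := Rabs l + 1).
  assert (HK : 1 <= K) by (unfold K; pose proof (Rabs_pos l); lra).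
  apply is_derive_Reals in Hl.
  destruct (Hl 1 ltac:(lra)) as [d Hd].
  (* V' (x0 + u) >= - K u gives V (x0 + u) >= - K u^2 / 2; the choice b = 2 K
     makes b^2 >= K since K >= 1. *)
  exists (2 * K), (Rmin 1 (d / 2)).
  pose proof (cond_pos d) as Hdp.
  split; [lra|]. split.
  { split; [apply Rmin_pos; lra | apply Rmin_l]. }
  assert (Hlin : forall u, 0 <= u <= Rmin 1 (d / 2) -> - (K * u) <= Derive V (x0 + u)).
  { intros u Hu. pose proof (Rmin_r 1 (d / 2)).
    destruct (Req_dec u 0) as [-> | Hne].
    - rewrite Rplus_0_r, HD0. lra.
    - specialize (Hd u Hne). rewrite HD0, (Rabs_right u) in Hd by lra.
      specialize (Hd ltac:(lra)). apply Rabs_def2 in Hd.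
      assert (Hq : - K <= (Derive V (x0 + u) - 0) / u).
      { pose proof (Rabs_maj2 l). unfold K. lra. }
      replace (Derive V (x0 + u)) with ((Derive V (x0 + u) - 0) / u * u)
        by (field; assumption).
      apply Rle_trans with (- K * u); [lra|].
      apply Rmult_le_compat_r; lra. }
  intros u Hu.
  assert (H : V (x0 + 0) + K * 0 ^ 2 / 2 <= V (x0 + u) + K * u ^ 2 / 2).
  { apply (is_derive_nondecreasing (fun u => V (x0 + u) + K * u ^ 2 / 2)
             (fun u => Derive V (x0 + u) + K * u)); [| | lra].
    - intros z _. auto_derive; [apply V_diff|].
      change (fun x : R => V x) with V. field.
    - intros z Hz. specialize (Hlin z ltac:(lra)). lra. }
  rewrite Rplus_0_r, Hx0 in H.
  assert (0 <= u ^ 2) by apply pow2_ge_0.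
  assert (K * u ^ 2 <= (2 * K) ^ 2 * u ^ 2).
  { apply Rmult_le_compat_r; nra. }
  lra.
Qed.

(** The crossing time is unbounded as the energy decreases to the maximum of
    the potential: the particle spends a logarithmically long time near a
    maximum. *)
Lemma crossing_large_at_low_energy (x0 p tau : R) :
  V x0 = 0 -> ex_derive (Derive V) x0 -> 0 < p ->
  exists E, 0 < E /\ 2 * E <= p ^ 2 /\ tau <= crossing V E.
Proof.
  intros Hx0 HD Hp.
  destruct (potential_quadratic_below_max x0 Hx0 HD) as (b & d & Hb & Hd & HV).
  (* The speed a at x0 is small enough for the logarithm ln (1 + b d / a) / b,
     the travel time over a distance d at speed a + b u, to exceed tau. *)
  set (a := Rmin p (b * d * exp (- (b * tau)))).
  assert (Hexp := exp_pos (- (b * tau))).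
  assert (Hbd : 0 < b * d) by (apply Rmult_lt_0_compat; lra).
  assert (Ha : 0 < a) by (apply Rmin_pos; [assumption | apply Rmult_lt_0_compat; lra]).
  assert (Hap : a <= p) by apply Rmin_l.
  assert (Had : a <= b * d * exp (- (b * tau))) by apply Rmin_r.
  exists (a ^ 2 / 2).
  assert (HE : 0 < a ^ 2 / 2) by nra.
  split; [assumption|]. split; [nra|].
  set (E := a ^ 2 / 2) in *.
  (* On [x0, x0 + d] the speed is at most a + b u. *)
  assert (Hslow : forall u, 0 <= u <= d -> / (a + b * u) <= slowness V E (x0 + u)).
  { intros u Hu. apply Rinv_le_contravar; [apply speed_pos, HE|].
    assert (0 <= b * u) by (apply Rmult_le_pos; lra).
    rewrite <- (sqrt_pow2 (a + b * u)) by lra.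
    apply sqrt_le_1_alt. specialize (HV u Hu). unfold E. nra. }
  assert (Hint : ln (1 + b * d / a) / b <= travel V E (x0 + d) - travel V E x0).
  { assert (H : travel V E (x0 + 0) - ln (1 + b * 0 / a) / b
                <= travel V E (x0 + d) - ln (1 + b * d / a) / b).
    { apply (is_derive_nondecreasing
               (fun u => travel V E (x0 + u) - ln (1 + b * u / a) / b)
               (fun u => slowness V E (x0 + u) - / (a + b * u))); [| |lra].
      - intros u Hu.
        assert (0 <= b * u) by (apply Rmult_le_pos; lra).
        assert (0 <= b * u / a) by (apply Rdiv_le_0_compat; assumption).
        apply (is_derive_minus (fun u => travel V E (x0 + u))).
        + replace (slowness V E (x0 + u)) with (1 * slowness V E (x0 + u)) by ring.
          apply (is_derive_comp (travel V E) (fun u => x0 + u)).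
          * apply is_derive_travel, HE.
          * auto_derive; trivial.
        + auto_derive; [lra|]. field. repeat split; lra.
      - intros u Hu. specialize (Hslow u Hu). lra. }
    rewrite Rplus_0_r in H. replace (1 + b * 0 / a) with 1 in H by (field; lra).
    rewrite ln_1 in H. lra. }
  assert (Hcross : travel V E (x0 + d) - travel V E x0 <= crossing V E).
  { pose proof (travel_shift E x0 HE).
    pose proof (travel_le E (x0 + d) (x0 + 1) HE ltac:(lra)). lra. }
  apply Rle_trans with (ln (1 + b * d / a) / b); [|lra].
  apply Rmult_le_reg_r with b; [assumption|].
  replace (ln (1 + b * d / a) / b * b) with (ln (1 + b * d / a)) by (field; lra).
  rewrite <- (ln_exp (tau * b)).
  apply ln_le; [apply exp_pos|].
  assert (exp (tau * b) <= b * d / a); [|lra].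
  apply Rmult_le_reg_r with a; [assumption|].
  replace (b * d / a * a) with (b * d) by (field; lra).
  apply Rle_trans with (exp (tau * b) * (b * d * exp (- (b * tau)))).
  { apply Rmult_le_compat_l; [apply Rlt_le, exp_pos | assumption]. }
  right. replace (- (b * tau)) with (- (tau * b)) by ring. rewrite exp_Ropp.
  field. apply Rgt_not_eq, exp_pos.
Qed.

End TravelTime.

(** * Dynamics *)

(** Conservation of twice the energy. *)
Lemma solves_ivp_energy (V : R -> R) (qa pa eps : R) (q : R -> R) :
  (forall x, ex_derive V x) -> 0 < eps -> solves_ivp V qa pa eps q ->
  forall t, Derive q t ^ 2 + 2 * V (q t / eps) = pa ^ 2 + 2 * V (qa / eps).
Proof.
  intros HV He (Hq & Hq2 & Hq0 & Hp0) t.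
  rewrite <- Hq0, <- Hp0.
  apply (is_derive_0_const (fun t => Derive q t ^ 2 + 2 * V (q t / eps))).
  intros s.
  pose proof (Hq2 s) as H2.
  assert (H2' : Derive (Derive q) s = - (1 / eps) * Derive V (q s / eps))
    by (apply is_derive_unique, H2).
  auto_derive.
  - repeat split; auto. exists (- (1 / eps) * Derive V (q s / eps)); exact H2.
  - change (fun x : R => Derive q x) with (Derive q).
    change (fun x : R => q x) with q. change (fun x : R => V x) with V.
    rewrite H2'. unfold Rdiv. field. lra.
Qed.

(** Above the maximum of the potential the velocity never vanishes, so it keeps
    its initial sign and is determined by the position. *)
Lemma solves_ivp_velocity (V : R -> R) (qa pa eps E : R) (q : R -> R) :
  (forall x, ex_derive V x) -> (forall x, V x <= 0) ->
  0 < eps -> 0 < pa -> 0 < E -> 2 * E = pa ^ 2 + 2 * V (qa / eps) ->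
  solves_ivp V qa pa eps q ->
  forall t, Derive q t = sqrt (2 * (E - V (q t / eps))).
Proof.
  intros HV HV0 He Hp HE HEeq Hsol.
  pose proof (solves_ivp_energy V qa pa eps q HV He Hsol) as Hen.
  destruct Hsol as (Hq & Hq2 & Hq0 & Hp0).
  assert (Hcont : continuity (Derive q)).
  { intros s. apply continuity_pt_filterlim.
    apply (ex_derive_continuous (Derive q)). eexists; apply Hq2. }
  assert (Hsq : forall s, 0 < Derive q s ^ 2).
  { intros s. specialize (Hen s). specialize (HV0 (q s / eps)). lra. }
  assert (Hpos : forall s, 0 < Derive q s).
  { intros s. destruct (Rlt_le_dec 0 (Derive q s)) as [H | H]; [assumption|].
    destruct (IVT_gen (Derive q) 0 s 0 Hcont) as [c [_ Hc]].
    - rewrite Hp0, Rmin_right, Rmax_left by lra. lra.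
    - specialize (Hsq c). rewrite Hc in Hsq. lra. }
  intros t. rewrite <- (sqrt_pow2 (Derive q t)) by (apply Rlt_le, Hpos).
  f_equal. specialize (Hen t). lra.
Qed.

(** At an energy above the maximum of the potential, the solution follows the
    line whose slope is the mean speed over a period. *)
Lemma solves_ivp_near_line (V : R -> R) (qa pa eps E : R) (q : R -> R) :
  (forall x, ex_derive V x) -> periodic 1 V -> (forall x, V x <= 0) ->
  0 < eps -> 0 < pa -> 0 < E -> 2 * E = pa ^ 2 + 2 * V (qa / eps) ->
  solves_ivp V qa pa eps q ->
  forall t, Rabs (q t - (/ crossing V E * t + qa)) <= 2 * eps.
Proof.
  intros HV Hper HV0 He Hp HE HEeq Hsol t.
  pose proof (solves_ivp_velocity V qa pa eps E q HV HV0 He Hp HE HEeq Hsol) as Hvel.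
  destruct Hsol as (Hq & _ & Hq0 & _).
  assert (Hd : forall s, is_derive (fun s => travel V E (q s / eps) - s / eps) s 0).
  { intros s.
    pose proof (speed_pos V HV0 E (q s / eps) HE) as Hsp.
    replace 0 with (Derive q s / eps * slowness V E (q s / eps) - / eps)
      by (rewrite Hvel; unfold slowness; field; split; lra).
    apply (is_derive_minus (fun s => travel V E (q s / eps))).
    - apply (is_derive_comp (travel V E) (fun s => q s / eps)).
      + apply is_derive_travel; assumption.
      + auto_derive; [apply Hq|].
        change (fun x : R => q x) with q. field. lra.
    - auto_derive; trivial. field. lra. }
  pose proof (is_derive_0_const _ Hd t 0) as Heq. cbv beta in Heq. rewrite Hq0 in Heq.
  pose proof (travel_near_linear V HV Hper HV0 E (q t / eps) HE) as B1.
  pose proof (travel_near_linear V HV Hper HV0 E (qa / eps) HE) as B2.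
  pose proof (crossing_pos V HV HV0 E HE) as HT.
  set (T := crossing V E) in *.
  apply Rabs_le_between in B1. apply Rabs_le_between in B2.
  assert (B : - (2 * T) <= t / eps - (q t - qa) / eps * T <= 2 * T).
  { replace ((q t - qa) / eps * T) with (q t / eps * T - qa / eps * T) by (field; lra).
    replace (0 / eps) with 0 in Heq by (field; lra). lra. }
  replace (q t - (/ T * t + qa))
    with (- ((t / eps - (q t - qa) / eps * T) * (eps / T))) by (field; lra).
  rewrite Rabs_Ropp, Rabs_mult, (Rabs_right (eps / T))
    by (apply Rle_ge, Rlt_le, Rdiv_lt_0_compat; assumption).
  replace (2 * eps) with (2 * T * (eps / T)) by (field; lra).
  apply Rmult_le_compat_r; [apply Rlt_le, Rdiv_lt_0_compat; assumption|].
  apply Rabs_le, B.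
Qed.

(** * Realising a prescribed energy along vanishing scales *)

Lemma periodic_Z (V : R -> R) (x : R) (n : Z) :
  periodic 1 V -> V (x + IZR n) = V x.
Proof.
  intros Hper.
  assert (Hnat : forall (m : nat) y, V (y + INR m) = V y).
  { intros m y. induction m as [|m IH].
    - simpl. f_equal. ring.
    - rewrite S_INR, <- Rplus_assoc, Hper. exact IH. }
  destruct (Z.le_gt_cases 0 n) as [Hn | Hn].
  - rewrite <- (Z2Nat.id n), <- INR_IZR_INZ by assumption. apply Hnat.
  - rewrite <- (Hnat (Z.to_nat (- n)) (x + IZR n)).
    rewrite INR_IZR_INZ, Z2Nat.id, opp_IZR by lia. f_equal. ring.
Qed.

(** Every value of a periodic function is taken at [qa / eps] for arbitrarily
    small [eps > 0]: shift the argument by integers towards infinity on the side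
    of [qa]. *)
Lemma periodic_value_at_small_scales (V : R -> R) (qa x0 : R) :
  periodic 1 V -> qa <> 0 ->
  exists eps : nat -> R,
    (forall k, 0 < eps k) /\ is_lim_seq eps 0 /\
    (forall k, V (qa / eps k) = V x0).
Proof.
  intros Hper Hqa.
  assert (Hs : exists s : Z, IZR s * qa = Rabs qa /\ IZR s * IZR s = 1).
  { destruct (Rle_lt_dec 0 qa).
    - exists 1%Z. rewrite Rabs_right by lra. lra.
    - exists (-1)%Z. rewrite Rabs_left by lra. lra. }
  (* s is the sign of qa, and eps k = |qa| / (s x0 + N + k), so that
     qa / eps k = x0 + s (N + k); the integer N makes the denominator at least
     k + 1. *)
  destruct Hs as (s & Hsq & Hss).
  assert (Hx : - Rabs x0 <= IZR s * x0).
  { assert (H : Rabs (IZR s * x0) = Rabs x0).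
    { rewrite Rabs_mult.
      assert (Rabs (IZR s) * Rabs (IZR s) = 1)
        by (rewrite <- Rabs_mult, Hss; apply Rabs_R1).
      pose proof (Rabs_pos (IZR s)). replace (Rabs (IZR s)) with 1 by nra. ring. }
    pose proof (Rabs_maj2 (IZR s * x0)). lra. }
  pose proof (archimed (Rabs x0)) as [HN _].
  set (N := (up (Rabs x0) + 1)%Z).
  assert (HN' : IZR N = IZR (up (Rabs x0)) + 1) by apply plus_IZR.
  set (D := fun k : nat => IZR s * x0 + IZR N + INR k).
  assert (HD : forall k, INR k + 1 <= D k) by (intros k; unfold D; lra).
  assert (HDpos : forall k, 0 < D k)
    by (intros k; specialize (HD k); pose proof (pos_INR k); lra).
  assert (Hqa' : 0 < Rabs qa) by (apply Rabs_pos_lt; assumption).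
  exists (fun k => Rabs qa / D k). split; [|split].
  - intros k. apply Rdiv_lt_0_compat; auto.
  - replace (Finite 0) with (Rbar_mult (Rabs qa) 0)
      by (simpl; f_equal; ring).
    apply (is_lim_seq_scal_l (fun k => / D k)).
    replace (Finite 0) with (Rbar_inv p_infty) by reflexivity.
    apply is_lim_seq_inv; [|discriminate].
    apply is_lim_seq_le_p_loc with (u := INR); [|apply is_lim_seq_INR].
    exists 0%nat. intros k _. specialize (HD k). lra.
  - intros k. rewrite <- (periodic_Z V x0 (s * (N + Z.of_nat k)) Hper). f_equal.
    rewrite mult_IZR, plus_IZR, <- INR_IZR_INZ.
    specialize (HDpos k). rewrite <- Hsq.
    replace (qa / (IZR s * qa / D k)) with (IZR s * D k).
    + unfold D.
      replace (IZR s * (IZR s * x0 + IZR N + INR k))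
        with (IZR s * IZR s * x0 + IZR s * (IZR N + INR k)) by ring.
      rewrite Hss. ring.
    + assert (IZR s <> 0) by (intros H0; rewrite H0 in Hss; lra).
      apply Rmult_eq_reg_l with (IZR s); [|assumption].
      rewrite <- Rmult_assoc, Hss. field. repeat split; auto; lra.
Qed.

Lemma converges_uniformly_of_rate (f : nat -> R -> R) (g : R -> R) (r : nat -> R) :
  is_lim_seq r 0 -> (forall k t, Rabs (f k t - g t) <= r k) ->
  converges_uniformly f g.
Proof.
  intros Hr Hfg P [d HP].
  apply is_lim_seq_spec in Hr. destruct (Hr d) as [N HN].
  exists N. intros k Hk. apply HP. intros t.
  change (Rabs (f k t - g t) < d).
  eapply Rle_lt_trans; [apply Hfg|].
  eapply Rle_lt_trans; [|apply (HN k Hk)].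
  rewrite Rminus_0_r. apply Rle_abs.
Qed.

(** * The limiting slopes *)

(** The interval of slopes: [(0, pa]] if [pa < sqrt (-2 * m)], and the single
    point [pa] otherwise. When [pa > sqrt (-2 * m)], [pa] is the only slope common
    to all potentials of minimum [m]. *)
Definition limit_slopes (m pa alpha : R) : Prop :=
  alpha = pa \/ (pa < sqrt (-2 * m) /\ 0 < alpha <= pa).

(** Each of these slopes is the mean speed at some positive energy that the
    initial velocity [pa] makes available. *)
Lemma energy_of_slope (V : R -> R) (m pa alpha : R) :
  is_Cn 2 V -> periodic 1 V -> is_max_of V 0 -> is_min_of V m ->
  0 < pa -> limit_slopes m pa alpha ->
  exists E, 0 < E /\ pa ^ 2 + 2 * m <= 2 * E <= pa ^ 2 /\ / crossing V E = alpha.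
Proof.
  intros [HC _] Hper [[x0 Hx0] HV0] [[x1 Hx1] Hmin] Hp Hal.
  assert (HV : forall x, ex_derive V x) by (intros x; apply (HC 1%nat); lia).
  assert (HV' : forall x, ex_derive (Derive V) x) by (intros x; apply (HC 2%nat); lia).
  assert (Hp2 : 0 < pa ^ 2) by (apply pow_lt; assumption).
  assert (Hm : m <= 0) by (rewrite <- Hx1; apply HV0).
  assert (Hal' : 0 < alpha <= pa) by (destruct Hal as [-> | [_ H]]; lra).
  assert (Hlow : exists E0, 0 < E0 /\ pa ^ 2 + 2 * m <= 2 * E0 <= pa ^ 2 /\
      / alpha <= crossing V E0).
  { destruct (Rlt_le_dec 0 (pa ^ 2 + 2 * m)) as [Hpos | Hneg].
    - (* All available energies are positive, so pa is the only slope. *)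
      assert (Heq : alpha = pa).
      { destruct Hal as [H | [H _]]; [assumption|].
        assert (pa * pa < sqrt (-2 * m) * sqrt (-2 * m))
          by (apply Rmult_le_0_lt_compat; lra).
        rewrite sqrt_def in * by lra. lra. }
      subst alpha. exists ((pa ^ 2 + 2 * m) / 2). split; [lra|]. split; [lra|].
      apply crossing_ge_inv; auto; [lra|].
      intros z. specialize (Hmin z). lra.
    - destruct (crossing_large_at_low_energy V HV Hper HV0 x0 pa (/ alpha) Hx0 (HV' x0) Hp)
        as (E0 & H1 & H2 & H3).
      exists E0. repeat split; auto; lra. }
  destruct Hlow as (E0 & HE0 & [HE1 HE2] & Hge).
  assert (Hle : crossing V (pa ^ 2 / 2) <= / alpha).
  { apply Rle_trans with (/ pa); [|apply Rinv_le_contravar; lra].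
    apply crossing_le_inv; auto; [lra|]. intros z; specialize (HV0 z); lra. }
  assert (Hex : exists E, E0 <= E <= pa ^ 2 / 2 /\ crossing V E = / alpha).
  { destruct (Req_dec (crossing V E0) (/ alpha)) as [H | H].
    { exists E0. split; [lra | assumption]. }
    destruct (Req_dec (crossing V (pa ^ 2 / 2)) (/ alpha)) as [H' | H'].
    { exists (pa ^ 2 / 2). split; [lra | assumption]. }
    assert (HE0lt : E0 < pa ^ 2 / 2).
    { destruct (Req_dec E0 (pa ^ 2 / 2)) as [He | He]; [|lra].
      rewrite He in Hge, H. lra. }
    destruct (Ranalysis5.IVT_interv (fun E => / alpha - crossing V E) E0 (pa ^ 2 / 2))
      as [E [HE Heq]]; try lra.
    - intros a Ha. apply continuity_pt_minus.
      + apply continuity_pt_const. intros u v; reflexivity.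
      + apply crossing_continuity_pt; auto. lra.
    - exists E. split; [assumption | lra]. }
  destruct Hex as (E & HE & Heq). exists E.
  split; [lra|]. split; [lra|]. rewrite Heq. apply Rinv_inv.
Qed.

Lemma Glb_Rbar_limit_slopes (m pa : R) :
  0 < pa -> pa < sqrt (-2 * m) -> Glb_Rbar (limit_slopes m pa) = Finite 0.
Proof.
  intros Hp Hlt. apply is_glb_Rbar_unique. split.
  - intros a [-> | [_ Ha]]; simpl; lra.
  - intros [b | |] Hb; simpl; auto.
    + destruct (Rle_lt_dec b 0) as [|Hpos]; [assumption|].
      assert (Hin : limit_slopes m pa (Rmin pa (b / 2))).
      { right. split; [assumption|]. split; [apply Rmin_pos; lra | apply Rmin_l]. }
      specialize (Hb _ Hin). simpl in Hb. pose proof (Rmin_r pa (b / 2)). lra.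
    + exact (Hb pa (or_introl eq_refl)).
Qed.

Theorem theorem2p4 :
  exists I : R -> R -> (R -> Prop),
  forall (V : R -> R) (minV qa pa : R),
    is_Cn 2 V -> periodic 1 V -> is_max_of V 0 -> is_min_of V minV ->
    qa <> 0 -> 0 < pa ->
    is_interval (I minV pa) /\
    (exists alpha : R, I minV pa alpha) /\
    (forall q : R -> R -> R,
       (forall eps : R, 0 < eps -> solves_ivp V qa pa eps (q eps)) ->
       forall alpha : R, I minV pa alpha ->
       exists eps : nat -> R,
         (forall k : nat, 0 < eps k) /\
         is_lim_seq eps 0 /\
         converges_uniformly (fun k : nat => q (eps k))
                             (fun t : R => alpha * t + qa)) /\
    (pa < sqrt (-2 * minV) -> Glb_Rbar (I minV pa) = Finite 0).
Proof.
  exists limit_slopes.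
  intros V m qa pa HC Hper Hmax Hmin Hqa Hp. split; [|split; [|split]].
  - intros x y z Hx Hz Hxyz. unfold limit_slopes in *.
    destruct (Rlt_le_dec pa (sqrt (-2 * m))) as [Hlt | Hge].
    + right. split; [assumption|]. lra.
    + left. lra.
  - exists pa. left. reflexivity.
  - intros q Hq alpha Hal.
    destruct (energy_of_slope V m pa alpha HC Hper Hmax Hmin Hp Hal)
      as (E & HE & HEm & Hcross).
    destruct HC as [HC _]. destruct Hmax as [[x0 Hx0] HV0]. destruct Hmin as [[x1 Hx1] _].
    assert (HV : forall x, ex_derive V x) by (intros x; apply (HC 1%nat); lia).
    destruct (IVT_gen V x1 x0 (E - pa ^ 2 / 2)) as [x [_ Hx]].
    { apply potential_continuity, HV. }
    { rewrite Hx0, Hx1, Rmin_left, Rmax_right by (rewrite <- Hx1; apply HV0). lra. }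
    destruct (periodic_value_at_small_scales V qa x Hper Hqa) as (eps & Hpos & Hlim & Hval).
    exists eps. split; [assumption|]. split; [assumption|].
    apply converges_uniformly_of_rate with (r := fun k => 2 * eps k).
    + replace (Finite 0) with (Rbar_mult 2 0) by (simpl; f_equal; ring).
      apply (is_lim_seq_scal_l eps 2 0), Hlim.
    + intros k t. rewrite <- Hcross.
      apply (solves_ivp_near_line V qa pa (eps k) E); auto.
      rewrite Hval, Hx. field.
  - intros Hlt. apply Glb_Rbar_limit_slopes; assumption.
Qed.
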